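(* Let $D\ge1$ be a square-free integer, $r>0$ a real number and $n\in\mathbb{N}$. The following hold: (i) Let $X\subset C_D(r)$ be a tight $n$-design. Then there exists some $(x,y)\in C_D(r)$ such that $X$ is the orbit of $(x,y)$ under the cyclic group $C^{(Q)}_{n+1}$ generated by the matrix $A_{2\pi/(n+1)}$. (ii) A rational tight $n$-design on an ellipse $C_D(r)$ exists only if $D\in\{1,3\}$.
   Context: For square-free $D\ge1$ and $r>0$: if $D\equiv 1,2 \pmod 4$, $C_D(r)=\{(x,y)\in\mathbb{R}^2: x^2+Dy^2=r\}$; if $D\equiv3\pmod 4$, $C_D(r)=\{(x,y)\in\mathbb{R}^2: x^2+xy+\frac{1+D}{4}y^2=r\}$. With $s$ the arc-length parameter on $C_D(r)$, the measure $d\tau$ is $d\tau=ds/\sqrt{x^2/D^2+y^2}$ for $D\equiv1,2\pmod4$ and $d\tau=ds/\sqrt{20x^2+(D^2+2D+5)y^2+(20+4D)xy}$ for $D\equiv 3\pmod 4$. The normalized integral is $I_{D,r}(f)=\frac{1}{2\pi\sqrt D}\int_{C_D(r)}f\,d\tau$ for $D\equiv1,2\pmod4$ and $I_{D,r}(f)=\frac{\sqrt D}{\pi}\int_{C_D(r)}f\,d\tau$ for $D\equiv3\pmod4$. Equivalently, $I_{D,r}(f)=\frac1{2\pi}\int_0^{2\pi}f(x(\theta),y(\theta))\,d\theta$, where $(x(\theta),y(\theta))=(\sqrt r\cos\theta,\sqrt r\sin\theta/\sqrt D)$ for $D\equiv1,2\pmod 4$ and $(x(\theta),y(\theta))=(\sqrt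 r(\cos\theta-\sin\theta/\sqrt D),\,2\sqrt r\sin\theta/\sqrt D)$ for $D\equiv3\pmod4$. A finite non-empty set $X\subset C_D(r)$ is an ellipsoidal $n$-design if $\frac1{\#X}\sum_{(x,y)\in X}f(x,y)=I_{D,r}(f)$ for all $f\in\mathbb{R}[x,y]$ with $\deg f\le n$. A tight $n$-design is an ellipsoidal $n$-design with exactly $n+1$ points. A design is rational if all coordinates of all its points are rational numbers. For $\phi\in\mathbb{R}$, $A_\phi=\begin{pmatrix}\cos\phi&-\sqrt D\sin\phi\\ \frac{\sin\phi}{\sqrt D}&\cos\phi\end{pmatrix}$ if $D\equiv1,2\pmod4$, and $A_\phi=\begin{pmatrix}\cos\phi-\frac{\sin\phi}{\sqrt D}&-\frac{D+1}{2\sqrt D}\sin\phi\\ \frac{2\sin\phi}{\sqrt D}&\cos\phi+\frac{\sin\phi}{\sqrt D}\end{pmatrix}$ if $D\equiv3\pmod4$; these matrices act on $\mathbb{R}^2$ (column vectors) and preserve $C_D(r)$.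
   Formalization: Part (ii) is stated only for n ≥ 2, because for n ≤ 1 it is false: {(1,0),(−1,0)} is a rational tight 1-design on C_D(1) for every D, and any single rational point is a rational tight 0-design. *)

(* Defs.v *)
From mathcomp Require Import all_boot all_order all_algebra.
From mathcomp Require Import finmap.
From mathcomp Require Import all_classical all_reals all_analysis.
(* The notations of mpoly clash with those of all_analysis. *)
From mathcomp Require mpoly.
Import (canonicals, coercions) mpoly.
From mathcomp Require Import ring lra.

Set Implicit Arguments.
Unset Strict Implicit.
Unset Printing Implicit Defensive.

Import Order.TTheory GRing.Theory Num.Theory.
Import numFieldNormedType.Exports.

Local Open Scope classical_set_scope.
Local Open Scope ring_scope.

Definition squarefree (D : nat) : Prop :=
  forall d : nat, (d * d %| D)%N -> d = 1%N.

Section EllipsoidalDesigns.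
Variable R : realType.
Implicit Types (D n : nat) (r phi t : R) (p : 'cV[R]_2).

Definition xc p : R := p ord0 ord0.
Definition yc p : R := p ord_max ord0.

Definition point (x y : R) : 'cV[R]_2 :=
  \col_(i < 2) if i == ord0 then x else y.

Definition mx22 (a b c d : R) : 'M[R]_2 :=
  \matrix_(i < 2, j < 2)
    if i == ord0 then (if j == ord0 then a else b)
    else (if j == ord0 then c else d).

(* For square-free D, the alternative to D = 3 mod 4 is D = 1, 2 mod 4. *)
Definition ellipse D r : set 'cV[R]_2 :=
  [set p | (if (D %% 4 == 3)%N
            then xc p ^+ 2 + xc p * yc p + (1 + D%:R) / 4 * yc p ^+ 2
            else xc p ^+ 2 + D%:R * yc p ^+ 2) = r].

Definition ellipse_param D r t : 'cV[R]_2 :=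
  if (D %% 4 == 3)%N
  then point (Num.sqrt r * (cos t - sin t / Num.sqrt D%:R))
             (2 * Num.sqrt r * sin t / Num.sqrt D%:R)
  else point (Num.sqrt r * cos t) (Num.sqrt r * sin t / Num.sqrt D%:R).

Definition speed (gamma : R -> 'cV[R]_2) t : R :=
  Num.sqrt (derive1 (xc \o gamma) t ^+ 2 + derive1 (yc \o gamma) t ^+ 2).

(* The integral of g over C_D(r) with respect to arc length: ellipse_param runs
   once around C_D(r) on [0, 2 pi], so ds = speed (ellipse_param D r) t dt. *)
Definition arclength_integral D r (g : 'cV[R]_2 -> R) : R :=
  (\int[lebesgue_measure]_(t in `[0, 2 * pi])
     (g (ellipse_param D r t) * speed (ellipse_param D r) t))%R.

Definition tau_density D p : R :=
  if (D %% 4 == 3)%N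
  then (Num.sqrt (20 * xc p ^+ 2 + (D%:R ^+ 2 + 2 * D%:R + 5) * yc p ^+ 2
                  + (20 + 4 * D%:R) * xc p * yc p))^-1
  else (Num.sqrt (xc p ^+ 2 / D%:R ^+ 2 + yc p ^+ 2))^-1.

Definition ellipse_mean D r (f : 'cV[R]_2 -> R) : R :=
  (if (D %% 4 == 3)%N then Num.sqrt D%:R / pi
   else (2 * pi * Num.sqrt D%:R)^-1)
  * arclength_integral D r (fun p => f p * tau_density D p).

Lemma derive1_cos_sin (a b t : R) :
  derive1 (fun u => a * cos u + b * sin u) t = - a * sin t + b * cos t.
Proof.
have h : is_derive t 1 (a \*: cos + b \*: sin) (a *: - sin t + b *: cos t).
  by apply: is_deriveD.
rewrite derive1E (_ : (fun u => _) = a \*: cos + b \*: sin) //.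
by rewrite derive_val /GRing.scale /= mulrN mulNr.
Qed.

Lemma speed_cos_sin (gamma : R -> 'cV[R]_2) (a b c d t : R) :
  (forall u, gamma u = point (a * cos u + b * sin u) (c * cos u + d * sin u)) ->
  speed gamma t =
  Num.sqrt ((- a * sin t + b * cos t) ^+ 2 + (- c * sin t + d * cos t) ^+ 2).
Proof.
move=> gammaE; rewrite /speed -!derive1_cos_sin.
have -> : xc \o gamma = fun u => a * cos u + b * sin u.
  by apply/funext => u; rewrite /= gammaE /xc mxE.
have -> // : yc \o gamma = fun u => c * cos u + d * sin u.
by apply/funext => u; rewrite /= gammaE /yc mxE.
Qed.

(* In the parameter t, the measure d tau is a constant multiple of dt, and
   ellipse_mean D r f is the mean of f (ellipse_param D r t) over [0, 2 pi]. *)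
Lemma tau_density_speed D r t : (0 < D)%N -> 0 < r ->
  tau_density D (ellipse_param D r t) * speed (ellipse_param D r) t =
  if (D %% 4 == 3)%N then (2 * Num.sqrt D%:R)^-1 else Num.sqrt D%:R.
Proof.
move=> D_gt0 r_gt0.
have D_gt0' : 0 < D%:R :> R by rewrite ltr0n.
have sD_gt0 : 0 < Num.sqrt D%:R :> R by rewrite sqrtr_gt0.
have sr_gt0 : 0 < Num.sqrt r by rewrite sqrtr_gt0.
have sqD : D%:R = Num.sqrt D%:R ^+ 2 :> R by rewrite sqr_sqrtr.
have cs := cos2Dsin2 t.
have sqrt_ratio (k q v : R) : 0 < k -> 0 < v -> v = k ^+ 2 * q ->
    (Num.sqrt q)^-1 * Num.sqrt v = k.
  move=> k_gt0 + vE; rewrite vE pmulr_rgt0 ?exprn_gt0// => q_gt0.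
  rewrite sqrtrM ?sqr_ge0// sqrtr_sqr gtr0_norm// mulrCA mulVf ?mulr1//.
  by rewrite gt_eqF // sqrtr_gt0.
rewrite /tau_density /ellipse_param; case: (D %% 4 == 3)%N.
  rewrite (@speed_cos_sin _ (Num.sqrt r) (- (Num.sqrt r / Num.sqrt D%:R))
    0 (2 * Num.sqrt r / Num.sqrt D%:R)); last first.
    by move=> u; congr point; field; rewrite ?gt_eqF.
  move: (Num.sqrt r) (Num.sqrt D%:R) sr_gt0 sD_gt0 sqD => p s p_gt0 s_gt0 ->.
  apply: sqrt_ratio; first by rewrite invr_gt0 mulr_gt0.
    rewrite lt0r addr_ge0 ?sqr_ge0 // andbT paddr_eq0 ?sqr_ge0 //.
    rewrite !expf_eq0 /=; apply/negP => /andP[/eqP e1 /eqP e2].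
    have c0 : cos t = 0.
      apply/eqP; have /eqP : 2 * p / s * cos t = 0 by lra.
      by rewrite mulf_eq0 gt_eqF // divr_gt0 // mulr_gt0.
    have s0 : sin t = 0.
      apply/eqP; have /eqP : p * sin t = 0 by move: e1; rewrite c0; lra.
      by rewrite mulf_eq0 gt_eqF.
    by move: cs; rewrite c0 s0; lra.
  by rewrite /xc /yc !mxE /=; field; rewrite ?gt_eqF.
rewrite (@speed_cos_sin _ (Num.sqrt r) 0 0 (Num.sqrt r / Num.sqrt D%:R)); last first.
  by move=> u; congr point; field; rewrite ?gt_eqF.
move: (Num.sqrt r) (Num.sqrt D%:R) sr_gt0 sD_gt0 sqD => p s p_gt0 s_gt0 ->.
apply: sqrt_ratio => //.
  rewrite lt0r addr_ge0 ?sqr_ge0 // andbT paddr_eq0 ?sqr_ge0 //.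
  rewrite !expf_eq0 /=; apply/negP => /andP[/eqP e1 /eqP e2].
  have c0 : cos t = 0.
    apply/eqP; have /eqP : p / s * cos t = 0 by lra.
    by rewrite mulf_eq0 gt_eqF // divr_gt0.
  have s0 : sin t = 0.
    apply/eqP; have /eqP : p * sin t = 0 by lra.
    by rewrite mulf_eq0 gt_eqF.
  by move: cs; rewrite c0 s0; lra.
by rewrite /xc /yc !mxE /=; field; rewrite ?gt_eqF.
Qed.

Definition poly_eval (f : mpoly.mpoly 2 R) p : R :=
  mpoly.meval (fun i => p i ord0) f.

(* msize is the total degree plus one, and msize 0 = 0. *)
Definition ellipsoidal_design D r n (X : {fset 'cV[R]_2}) : Prop :=
  [/\ X != fset0,
      [set` X] `<=` ellipse D r &
      forall f : mpoly.mpoly 2 R, (mpoly.msize f <= n.+1)%N ->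
        (#|` X|)%:R^-1 * (\sum_(p <- X) poly_eval f p)
        = ellipse_mean D r (poly_eval f)].

Definition tight_design D r n (X : {fset 'cV[R]_2}) : Prop :=
  ellipsoidal_design D r n X /\ #|` X| = n.+1.

(* Rational tight n-designs with n <= 1 exist for every D: any rational point of
   C_D(r) when n = 0, and {(1, 0), (-1, 0)} on C_D(1) when n = 1. *)
Definition rational_design (X : {fset 'cV[R]_2}) : Prop :=
  forall p, p \in X -> forall i : 'I_2, exists q : rat, p i ord0 = ratr q.

Definition A_mx D phi : 'M[R]_2 :=
  let s := Num.sqrt D%:R in
  if (D %% 4 == 3)%N
  then mx22 (cos phi - sin phi / s) (- ((D%:R + 1) / (2 * s) * sin phi))
            (2 * sin phi / s)       (cos phi + sin phi / s)
  else mx22 (cos phi)     (- (s * sin phi))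
            (sin phi / s) (cos phi).

Lemma A_mx_unit D phi : (0 < D)%N -> A_mx D phi \in unitmx.
Proof.
move=> D_gt0; have s_neq0 : Num.sqrt (D%:R : R) != 0.
  by rewrite sqrtr_eq0 -ltNge ltr0n.
rewrite unitmxE; suff -> : \det (A_mx D phi) = 1 by rewrite unitr1.
have sqD : D%:R = Num.sqrt D%:R ^+ 2 :> R by rewrite sqr_sqrtr.
transitivity (cos phi ^+ 2 + sin phi ^+ 2); last exact: cos2Dsin2.
rewrite (expand_det_row _ ord0) !big_ord_recl big_ord0 /cofactor !det_mx11.
rewrite /A_mx /=; case: ifP => _; rewrite !mxE /= !expr1 expr0;
  by move: (Num.sqrt D%:R) s_neq0 sqD => s s_neq0 sD; rewrite ?sD; field.
Qed.

(* The cyclic group generated by A_{2 pi / (n + 1)}. The powers range over all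
   integers; A ^ k with k < 0 is a power of the inverse matrix, by A_mx_unit. *)
Definition cyclic_group D n : set 'M[R]_2 :=
  [set A_mx D (2 * pi / n.+1%:R) ^ k | k in [set: int]].

Definition group_orbit (G : set 'M[R]_2) p : set 'cV[R]_2 :=
  [set A *m p | A in G].

End EllipsoidalDesigns.

(* Main.v *)
Require Import Defs.
From mathcomp Require Import all_boot all_order all_algebra.
From mathcomp Require Import finmap.
From mathcomp Require Import all_classical all_reals all_analysis.
From mathcomp Require mpoly.
Import (canonicals, coercions) mpoly.
From mathcomp Require Import ring lra zify.
From mathcomp Require Import complex.

(* In the coordinate [z] in which [C_D(r)] is the circle [|z|^2 = r], the real
   and imaginary parts of [z^k] are polynomials of degree [k] in [x, y] with
   mean zero, so the first [n] power sums of the [n + 1] points [z_j] of a tight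
   design vanish. Then [P = \prod_j (X - z_j)] is [X^(n + 1) - c], and the
   [z_j] form a regular polygon. For a rational tight design, the rotation
   relating two adjacent points has [cos phi] and [sin phi / sqrt D] rational.
   As a rational algebraic integer, [2 cos phi] is an integer [m], whence
   [D (2 sin phi / sqrt D)^2 = 4 - m^2] with [|m| <= 1]. *)

Set Implicit Arguments.
Unset Strict Implicit.
Unset Printing Implicit Defensive.

Import Order.TTheory GRing.Theory Num.Theory.
Import numFieldNormedType.Exports.

Local Open Scope classical_set_scope.
Local Open Scope ring_scope.

(** * Vanishing power sums and the coefficients of a polynomial *)

Lemma power_sums_eq0_const (F : numFieldType) (ws : seq F) :
  uniq ws ->
  (forall k, (0 < k < size ws)%N -> \sum_(w <- ws) w ^+ k = 0) ->
  exists c, forall w, w \in ws -> w ^+ size ws = c.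
Proof.
(* With [P = \prod_w (X - w)], evaluating the mean of [P / (X - w)] gives
   [w P'(w) = - N P(0)], so [X P' - N P + N P(0)] has size at most [N] and
   vanishes at the [N] points [w]: it is zero. *)
move=> ws_uniq sums0; have [->|ws_neq0] := eqVneq ws [::]; first by exists 0.
have N_gt0 : (0 < size ws)%N by rewrite lt0n size_eq0.
set N := size ws in N_gt0 *.
(* Only the constant coefficient of [Q] survives the sum, since all exponents stay below [N]. *)
have meanE (Q : {poly F}) : (size Q <= N)%N ->
    \sum_(w <- ws) Q.[w] = Q.[0] *+ N.
  move=> sQ; rewrite horner_coef0.
  have [->|Q_neq0] := eqVneq Q 0.
    by rewrite coef0 mul0rn big1 // => w _; rewrite horner0.
  under eq_bigr => w _ do rewrite horner_coef.
  rewrite exchange_big /=; have := Q_neq0; rewrite -size_poly_gt0.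
  case: (size Q) sQ => // m sQ _; rewrite big_ord_recl [X in _ + X]big1 => [|i _].
    rewrite addr0 -mulr_sumr; under eq_bigr => w _ do rewrite expr0.
    by rewrite big_const_seq count_predT iter_addr_0 mulr_natr.
  by rewrite -mulr_sumr sums0 ?mulr0 //= (leq_trans _ sQ) // ltnS.
pose P := \prod_(w <- ws) ('X - w%:P).
have sizeP : size P = N.+1 by rewrite size_prod_XsubC.
have P_monic : P \is monic by apply: monic_prod_XsubC.
have derivP w : w \in ws -> w * P^`().[w] = - P.[0] *+ N.
  move=> w_ws; pose Q := \prod_(v <- rem w ws) ('X - v%:P).
  have PE : P = ('X - w%:P) * Q by rewrite /P (big_rem w).
  have Q0 v : v \in ws -> v != w -> Q.[v] = 0.
    move=> v_ws v_neq; apply/rootP; rewrite root_prod_XsubC.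
    by rewrite (mem_rem_uniq w ws_uniq) !inE v_neq.
  have -> : P^`().[w] = Q.[w].
    by rewrite PE derivM derivXsubC mul1r hornerD hornerM hornerXsubC
      subrr mul0r addr0.
  have := meanE Q; rewrite size_prod_XsubC size_rem // -/N.
  rewrite prednK // => /(_ (leqnn _)); rewrite (bigD1_seq w) //= big1_seq; last first.
    by move=> v /andP[? ?]; apply: Q0.
  rewrite addr0 => ->.
  by rewrite PE hornerM hornerXsubC sub0r mulNr opprK mulrnAr.
pose S := 'X * P^`() - P *+ N + (P.[0] *+ N)%:P.
have coefS k : (0 < k)%N -> S`_k = P`_k *+ k - P`_k *+ N.
  by case: k => // k _; rewrite coefD coefB coefMn coefXM coef_deriv coefC /= addr0.
have S_eq0 : S = 0.
  apply: (@roots_geq_poly_eq0 _ _ ws) => //.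
    apply/allP => w w_ws; apply/rootP.
    have /rootP Pw : root P w by rewrite root_prod_XsubC.
    rewrite /S hornerD hornerD hornerN hornerMn hornerC hornerM hornerX Pw.
    by rewrite derivP // mul0rn subr0 mulNrn addNr.
  apply/leq_sizeP => k; rewrite -/N leq_eqVlt => /orP[/eqP <-|k_gt].
    by rewrite coefS // subrr.
  by rewrite coefS ?(leq_ltn_trans _ k_gt) // nth_default ?sizeP // !mul0rn subrr.
(* The coefficients of [S = 0] give [(k - N) P_k = 0], and the characteristic is zero. Thus
   [P = X^N + P_0], and [c] is [- P_0]. *)
have P0 k : (0 < k < N)%N -> P`_k = 0.
  move=> /andP[k_gt0 k_lt]; have := coefS k k_gt0.
  rewrite S_eq0 coef0 => /esym/eqP; rewrite -[P`_k *+ k]mulr_natr -[P`_k *+ N]mulr_natr -mulrBr.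
  rewrite mulf_eq0 subr_eq0 eqr_nat => /orP[/eqP //|/eqP E].
  by rewrite E ltnn in k_lt.
exists (- P`_0) => w w_ws; rewrite -/N.
have /rootP : root P w by rewrite root_prod_XsubC.
rewrite horner_coef sizeP big_ord_recr /=.
have -> : P`_N = 1 by rewrite -(monicP P_monic) lead_coefE sizeP.
rewrite mul1r => /eqP; rewrite addrC addr_eq0 => /eqP ->; congr (- _).
case: (N) N_gt0 P0 => // m _ P0; rewrite big_ord_recl expr0 mulr1 big1 ?addr0 //.
by move=> i _; rewrite P0 ?mul0r //= /bump /= ltnS ltn_ord.
Qed.

(** * Arithmetic of [2 cos phi] and of square-free [D] *)

(* [a = 2 cos phi] is a root of the monic integral polynomial expressing
   [2 cos (N phi) - 2]; the denominator bound is checked on the recurrence. *)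
Lemma rational_cos_denq (R : realType) (a : rat) (phi : R) (N : nat) :
  (0 < N)%N -> ratr a = 2 * cos phi -> cos (N%:R * phi) = 1 -> denq a = 1.
Proof.
case: N => // N _ aE cosN.
pose t k : R := 2 * cos (k%:R * phi).
pose m : R := (numq a)%:~R; pose d : R := (denq a)%:~R.
have d_neq0 : d != 0 by rewrite intr_eq0 denq_neq0.
have adE : t 1%N * d = m.
  by rewrite /t mul1r -aE /ratr mulfVK.
have rec k : t k.+2 = t 1%N * t k.+1 - t k.
  rewrite /t mul1r.
  have -> : k.+2%:R * phi = k.+1%:R * phi + phi by rewrite -[k.+2]addn1 natrD; ring.
  have -> : k%:R * phi = k.+1%:R * phi - phi by rewrite -[k.+1]addn1 natrD; ring.
  by rewrite cosD cosB; ring.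
(* The congruence modulo [d] fails to start at index 0, where [t 0 = 2]. Integrality is enough at
   the lower index, because the recurrence multiplies that term by [d ^+ 2]. *)
have key k : (exists e : int, t k * d ^+ k = e%:~R) /\
    (exists e : int, t k.+1 * d ^+ k.+1 = m ^+ k.+1 + d * e%:~R).
  elim: k => [|k [[e0 E0] [e1 E1]]].
    split; first by exists 2; rewrite /t mul0r cos0 expr0 !mulr1.
    by exists 0; rewrite !expr1 adE mulr0 addr0.
  split.
    by exists (numq a ^+ k.+1 + denq a * e1); rewrite E1 rmorphD rmorphM rmorphXn.
  exists (numq a * e1 - denq a * e0); rewrite rec.
  rewrite rmorphB !rmorphM /= -/m -/d -E0.
  transitivity (t 1%N * d * (t k.+1 * d ^+ k.+1) - d ^+ 2 * (t k * d ^+ k)).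
    by rewrite !exprS expr0; ring.
  by rewrite E1 adE [m ^+ k.+2]exprS; ring.
(* Since [t N.+1 = 2], the congruence shows that [d] divides [m ^+ N.+1], while [m] and [d] are
   coprime. *)
have [_ [e]] := key N.
rewrite {1}/t cosN mulr1 => /eqP; rewrite -subr_eq => /eqP eqm.
have : (denq a %| numq a ^+ N.+1)%Z.
  apply/dvdzP; exists (2 * denq a ^+ N - e); apply/eqP.
  rewrite -(eqr_int R) rmorphXn /= -/m -eqm.
  by rewrite !rmorphM rmorphB rmorphM rmorphXn /= -/d [d ^+ N.+1]exprS; apply/eqP; ring.
move=> dv; have : coprimez (denq a) (numq a ^+ N.+1).
  by apply: coprimezXr; rewrite coprimez_sym; exact: coprime_num_den.
move: dv; rewrite dvdzE coprimezE => /coprime_dvdr H /H.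
rewrite /coprime gcdnn => /eqP E.
by have := denq_gt0 a; move: E; case: (denq a) => // n /= ->.
Qed.

(** With [e = a / b] up to sign in lowest terms, [D a^2 = M b^2], so [b^2] divides [D] and [b = 1].
    Then [a = 1] gives [D = M], where 4 is not square-free; [a = 2] gives [D = 1]; and [a >= 3] is
    too large. *)
Lemma squarefree_mul_sqr_eq (D M : nat) (e : rat) :
  (0 < D)%N -> squarefree D -> (M == 3) || (M == 4) ->
  D%:R * e ^+ 2 = M%:R -> D = 1%N \/ D = 3%N.
Proof.
move=> D_gt0 D_sqf M34 eqM.
pose a := `|numq e|%N; pose b := `|denq e|%N.
have b_gt0 : (0 < b)%N by rewrite absz_gt0 denq_neq0.
have eqab : (D * a ^ 2 = M * b ^ 2)%N.
  apply/eqP; rewrite -(eqr_nat rat) -!mulnn !natrM -!expr2.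
  have bE : b%:R = (denq e)%:~R :> rat by rewrite /b -[LHS]/((Posz b)%:~R) absz_denq.
  have aE : (a%:R : rat) ^+ 2 = (numq e)%:~R ^+ 2.
    rewrite -[a%:R]/((Posz a)%:~R).
    have [->|->] : Posz a = numq e \/ Posz a = - numq e by rewrite /a; lia.
      by [].
    by rewrite rmorphN sqrrN.
  by rewrite aE bE -eqM -mulrA -exprMn -numqE.
have b1 : b = 1%N.
  apply: D_sqf; rewrite mulnn -(@Gauss_dvdl _ _ (a ^ 2)).
    by rewrite eqab dvdn_mull.
  by rewrite coprimeXl // coprimeXr // coprime_sym; exact: coprime_num_den.
move: eqab; rewrite b1 muln1 => eqa.
case: {b1 b_gt0} (a) eqa => [|[|[|k]]] eqa.
- by rewrite muln0 in eqa; rewrite -eqa in M34.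
- by rewrite muln1 in eqa; rewrite {}eqa in D_sqf *; case/orP: M34 => /eqP ME;
    [right | have := D_sqf 2%N; rewrite ME => /(_ isT)].
- by left; case/orP: M34 => /eqP ME; lia.
rewrite -mulnn in eqa; exfalso.
by case/orP: M34 => /eqP ME; nia.
Qed.

(** * The complex coordinate on the ellipse *)

Section ComplexCoordinate.
Variable R : realType.
Implicit Types (D : nat) (r t : R) (p : 'cV[R]_2).

(* The coordinate [z] in which [C_D(r)] is the circle [|z|^2 = r] and
   [A_phi] is the rotation by [phi]. *)
Definition ellipse_coord D p : R[i] :=
  if (D %% 4 == 3)%N
  then Complex (xc p + yc p / 2) (Num.sqrt D%:R * (yc p / 2))
  else Complex (xc p) (Num.sqrt D%:R * yc p).

Definition cis t : R[i] := Complex (cos t) (sin t).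

Lemma cisD s t : cis (s + t) = cis s * cis t.
Proof. by rewrite /cis cosD sinD; congr Complex; rewrite addrC. Qed.

Lemma cisX t k : cis t ^+ k = cis (k%:R * t).
Proof.
elim: k => [|k IHk]; first by rewrite expr0 mul0r /cis cos0 sin0.
by rewrite exprS IHk -cisD -[k.+1]add1n natrD mulrDl mul1r.
Qed.

Lemma cis_neq0 t : cis t != 0.
Proof.
apply/eqP => c0; have := cisD t (- t).
by rewrite subrr c0 mul0r /cis cos0 => -[/eqP]; rewrite oner_eq0.
Qed.

Lemma sqrt_nat_gt0 D : (0 < D)%N -> 0 < Num.sqrt D%:R :> R.
Proof. by move=> D_gt0; rewrite sqrtr_gt0 ltr0n. Qed.

Lemma sqr_sqrt_nat D : Num.sqrt D%:R ^+ 2 = D%:R :> R.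
Proof. by rewrite sqr_sqrtr. Qed.

Lemma ellipse_coord_inj D : (0 < D)%N -> injective (ellipse_coord D).
Proof.
move=> D_gt0 p q; have s_neq0 : Num.sqrt (D%:R : R) != 0.
  by rewrite gt_eqF // sqrt_nat_gt0.
have colE (v w : 'cV[R]_2) : xc v = xc w -> yc v = yc w -> v = w.
  move=> ex ey; apply/matrixP => i j; rewrite (ord1 j).
  case: i => -[|[|//]] ilt.
    by move: ex; rewrite /xc (_ : Ordinal ilt = ord0) //; apply/val_inj.
  by move: ey; rewrite /yc (_ : Ordinal ilt = ord_max) //; apply/val_inj.
rewrite /ellipse_coord; case: (D %% 4 == 3)%N => -[ex /(mulfI s_neq0) ey]; apply: colE; lra.
Qed.

(** For [D = 3 mod 4] this completes the square: [x^2 + x y + (1 + D)/4 y^2 = (x + y/2)^2 + D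
    (y/2)^2]. *)
Lemma ellipse_coord_norm D r p : ellipse D r p ->
  complex.Re (ellipse_coord D p) ^+ 2 + complex.Im (ellipse_coord D p) ^+ 2 = r.
Proof.
rewrite /ellipse /ellipse_coord /=; case: (D %% 4 == 3)%N => /= <-;
  by rewrite exprMn sqr_sqrt_nat; field.
Qed.

Lemma ellipse_coord_neq0 D r p : 0 < r -> ellipse D r p ->
  ellipse_coord D p != 0.
Proof.
move=> r_gt0 /ellipse_coord_norm; apply: contra_eqN => /eqP ->.
by rewrite expr0n addr0 lt_eqF.
Qed.

Lemma ellipse_coord_param D r t : (0 < D)%N ->
  ellipse_coord D (ellipse_param D r t) = Complex (Num.sqrt r) 0 * cis t.
Proof.
move=> /sqrt_nat_gt0 s_gt0; rewrite /ellipse_coord /ellipse_param /cis.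
case: (D %% 4 == 3)%N; rewrite /xc /yc !mxE /=; congr Complex; field;
  by rewrite ?gt_eqF.
Qed.

Lemma ellipse_coord_A_mx D phi p : (0 < D)%N ->
  ellipse_coord D (A_mx D phi *m p) = cis phi * ellipse_coord D p.
Proof.
move=> /sqrt_nat_gt0/lt0r_neq0; have := sqr_sqrt_nat D.
rewrite /ellipse_coord /A_mx /cis /xc /yc.
move: (Num.sqrt D%:R) => s <- s_neq0.
have ord1E : lift ord0 ord0 = ord_max :> 'I_2 by exact/val_inj.
case: (D %% 4 == 3)%N; rewrite !mxE !big_ord_recl !big_ord0 !mxE /= !ord1E.
  by congr Complex; field; rewrite ?s_neq0.
by congr Complex; field; rewrite ?s_neq0.
Qed.

(** * Test polynomials, their means and the power sums of a design *)

Lemma msizeM_leq (f g : mpoly.mpoly 2 R) m k :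
  (mpoly.msize f <= m.+1)%N -> (mpoly.msize g <= k.+1)%N ->
  (mpoly.msize (f * g) <= (m + k).+1)%N.
Proof.
have [->|f_neq0] := eqVneq f 0; first by rewrite mul0r mpoly.mmeasure0.
have [->|g_neq0] := eqVneq g 0; first by rewrite mulr0 mpoly.mmeasure0.
rewrite mpoly.msizeM // => f_le g_le.
by have := leq_add f_le g_le; rewrite addSn addnS; case: (_ + _)%N.
Qed.

Lemma linear_mpoly (a b : R) : exists2 f : mpoly.mpoly 2 R,
  (mpoly.msize f <= 2)%N & forall p, poly_eval f p = a * xc p + b * yc p.
Proof.
exists (a *: mpoly.mpolyX R (mpoly.mnm1 ord0)
        + b *: mpoly.mpolyX R (mpoly.mnm1 ord_max)).
  apply: (leq_trans (mpoly.msizeD_le _ _)); rewrite geq_max.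
  by rewrite !(leq_trans (mpoly.msizeZ_le _ _)) // mpoly.msizeX mpoly.mdeg1.
by move=> p; rewrite /poly_eval mpoly.mevalD !mpoly.mevalZ !mpoly.mevalXU.
Qed.

(** As [z] is linear in [x, y], each multiplication by [z] raises the degree by at most one. This
    makes [z^k] accessible to the design condition. *)
Lemma ellipse_coordX_mpoly D k : exists f g : mpoly.mpoly 2 R,
  [/\ (mpoly.msize f <= k.+1)%N, (mpoly.msize g <= k.+1)%N &
      forall p, ellipse_coord D p ^+ k = Complex (poly_eval f p) (poly_eval g p)].
Proof.
elim: k => [|k [f [g [f_le g_le fgE]]]].
  exists 1, 0; split=> [||p]; rewrite ?mpoly.msize1 ?mpoly.mmeasure0 //.
  by rewrite expr0 /poly_eval mpoly.meval1 mpoly.meval0.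
have [u [v [u_le v_le uvE]]] : exists u v : mpoly.mpoly 2 R,
    [/\ (mpoly.msize u <= 2)%N, (mpoly.msize v <= 2)%N &
      forall p, ellipse_coord D p = Complex (poly_eval u p) (poly_eval v p)].
  rewrite /ellipse_coord; case: (D %% 4 == 3)%N.
    have [u u_le uE] := linear_mpoly 1 2^-1.
    have [v v_le vE] := linear_mpoly 0 (Num.sqrt D%:R / 2).
    by exists u, v; split=> // p; rewrite uE vE; congr Complex; field.
  have [u u_le uE] := linear_mpoly 1 0.
  have [v v_le vE] := linear_mpoly 0 (Num.sqrt D%:R).
  by exists u, v; split=> // p; rewrite uE vE; congr Complex; ring.
exists (u * f - v * g), (u * g + v * f); split=> [||p].
- apply: (leq_trans (mpoly.msizeD_le _ _)).
  rewrite geq_max mpoly.msizeN.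
  by apply/andP; split; exact: (@msizeM_leq _ _ 1 k).
- apply: (leq_trans (mpoly.msizeD_le _ _)).
  rewrite geq_max.
  by apply/andP; split; exact: (@msizeM_leq _ _ 1 k).
rewrite exprS fgE uvE /poly_eval mpoly.mevalB mpoly.mevalD !mpoly.mevalM.
by [].
Qed.

(** By [tau_density_speed] the measure is a constant multiple of [dt], and a pure frequency [k > 0]
    has a periodic antiderivative, here [G]. *)
Lemma ellipse_mean_trig D r k (a b : R) (f : 'cV[R]_2 -> R) :
  (0 < D)%N -> 0 < r -> (0 < k)%N ->
  (forall t, f (ellipse_param D r t) =
     a * cos (k%:R * t) + b * sin (k%:R * t)) ->
  ellipse_mean D r f = 0.
Proof.
move=> D_gt0 r_gt0 k_gt0 fE; rewrite /ellipse_mean /arclength_integral.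
pose c : R := if (D %% 4 == 3)%N then (2 * Num.sqrt D%:R)^-1 else Num.sqrt D%:R.
pose g t := c * (a * cos (k%:R * t) + b * sin (k%:R * t)).
pose G t := c / k%:R * (a * sin (k%:R * t) - b * cos (k%:R * t)).
have k_neq0 : k%:R != 0 :> R by rewrite pnatr_eq0 -lt0n.
have dG t : is_derive t 1 G (g t).
  rewrite /G /g.
  apply: is_derive_eq.
  rewrite /GRing.scale /=.
  by field.
have cts (h : R -> R) (h' : R -> R) :
    (forall t, is_derive t 1 h (h' t)) -> continuous h.
  by move=> dh t; apply/differentiable_continuous/derivable1_diffP; case: (dh t).
have cg : continuous g.
  apply: (cts _ (fun t => c * k%:R * (b * cos (k%:R * t) - a * sin (k%:R * t)))).
  move=> t; rewrite /g; apply: is_derive_eq; rewrite /GRing.scale /=; ring.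
have cG := cts _ _ dG.
transitivity ((if (D %% 4 == 3)%N then Num.sqrt D%:R / pi
   else (2 * pi * Num.sqrt D%:R)^-1) * (G (2 * pi) - G 0)).
  congr (_ * _); under eq_Rintegral => t _.
    rewrite -mulrA tau_density_speed // fE mulrC -/c -/(g t); over.
  rewrite /Rintegral (continuous_FTC2 (F := G)) //.
  - by rewrite mulr_gt0 ?pi_gt0.
  - by apply: continuous_subspaceT.
  - split; first by move=> t _; case: (dG t).
      by apply: cvg_at_right_filter; apply: cG.
    by apply: cvg_at_left_filter; apply: cG.
  - by move=> t _; rewrite derive1E; apply: derive_val.
(* De Moivre's formula turns this into the values of [cos] and [sin] at [k (2 pi)]. *)
have : cis (2 * pi) ^+ k = 1.
  by rewrite (_ : cis _ = 1) ?expr1n // /cis mulrC mulr_natr cos2pi sin2pi.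
rewrite cisX => -[cE sE].
by rewrite /G cE sE !mulr0 cos0 sin0 mulr0 subrr mulr0.
Qed.

(** On the ellipse the real and imaginary parts of [z^k] are [r^(k/2) cos (k t)] and
    [r^(k/2) sin (k t)]; both are admissible test polynomials because [k <= n]. *)
Lemma design_power_sum D r n (X : {fset 'cV[R]_2}) k :
  (0 < D)%N -> 0 < r -> ellipsoidal_design D r n X -> (0 < k <= n)%N ->
  \sum_(p <- X) ellipse_coord D p ^+ k = 0.
Proof.
move=> D_gt0 r_gt0 [X_neq0 X_sub designP] /andP[k_gt0 k_le].
have [f [g [f_le g_le fgE]]] := ellipse_coordX_mpoly D k.
have sum0 h a b : (mpoly.msize h <= k.+1)%N ->
    (forall t, poly_eval h (ellipse_param D r t) =
       a * cos (k%:R * t) + b * sin (k%:R * t)) ->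
    \sum_(p <- X) poly_eval h p = 0.
  move=> h_le hE; have := designP h (leq_trans h_le (k_le : (k.+1 <= n.+1)%N)).
  rewrite (ellipse_mean_trig D_gt0 r_gt0 k_gt0 hE) => /eqP.
  rewrite mulf_eq0 invr_eq0 pnatr_eq0 cardfs_eq0 (negPf X_neq0) /=.
  by move/eqP.
have paramE t : Complex (poly_eval f (ellipse_param D r t))
                        (poly_eval g (ellipse_param D r t)) =
    Complex (Num.sqrt r ^+ k * cos (k%:R * t)) (Num.sqrt r ^+ k * sin (k%:R * t)).
  rewrite -fgE ellipse_coord_param // exprMn cisX.
  rewrite -[Complex (Num.sqrt r) 0]/((Num.sqrt r)%:C)%C -rmorphXn /=.
  by congr Complex; ring.
have f0 : \sum_(p <- X) poly_eval f p = 0.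
  apply: (sum0 _ (Num.sqrt r ^+ k) 0) => // t; case: (paramE t) => -> _; ring.
have g0 : \sum_(p <- X) poly_eval g p = 0.
  apply: (sum0 _ 0 (Num.sqrt r ^+ k)) => // t; case: (paramE t) => _ ->; ring.
transitivity (Complex (\sum_(p <- X) poly_eval f p) (\sum_(p <- X) poly_eval g p)).
  elim/big_rec3: _ => // p x y z _ ->; by rewrite fgE.
by rewrite f0 g0.
Qed.


(** * Roots of unity and the orbit of a tight design *)

(** An order [m < n + 1] would give [cos (2 h) = 1] with [h = m pi / (n + 1)] strictly between 0 and
    [pi], against [sin h > 0]. *)
Lemma cis_primitive n : n.+1.-primitive_root (cis (2 * pi / n.+1%:R)).
Proof.
have N_neq0 : n.+1%:R != 0 :> R by rewrite pnatr_eq0.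
have cisN : cis (2 * pi / n.+1%:R) ^+ n.+1 = 1.
  rewrite cisX mulrC divfK //.
  by rewrite /cis mulrC mulr_natr cos2pi sin2pi.
have [m m_prim m_dvd] := prim_order_exists (ltn0Sn n) cisN.
have m_gt0 := prim_order_gt0 m_prim.
have := m_prim; suff -> : m = n.+1 by [].
apply/eqP; rewrite eqn_leq dvdn_leq //= leqNgt; apply/negP => m_lt.
have := prim_expr_order m_prim; rewrite cisX => -[cosE _].
pose h : R := m%:R * pi / n.+1%:R.
have hE : m%:R * (2 * pi / n.+1%:R) = h *+ 2 by rewrite /h; field.
have : 0 < sin h.
  apply: sin_gt0_pi; rewrite /h divr_gt0 ?mulr_gt0 ?pi_gt0 ?ltr0n //=.
  by rewrite ltr_pdivrMr ?ltr0n // mulrC ltr_pM2l ?pi_gt0 // ltr_nat.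
move: cosE; rewrite hE cos_mulr2n cos2sin2 => cosE s_gt0.
have : sin h ^+ 2 = 0 by lra.
by move/eqP; rewrite sqrf_eq0 gt_eqF.
Qed.

Lemma ellipse_coord_A_mxX D phi p (k : int) : (0 < D)%N ->
  ellipse_coord D (A_mx D phi ^ k *m p) = cis phi ^ k * ellipse_coord D p.
Proof.
move=> D_gt0.
have posE m q : ellipse_coord D (A_mx D phi ^+ m *m q)
    = cis phi ^+ m * ellipse_coord D q.
  elim: m => [|m IHm]; first by rewrite expr0 mul1mx expr0 mul1r.
  by rewrite !exprS -mulmxA ellipse_coord_A_mx // IHm mulrA.
case: k => m; first by rewrite -!exprnP posE.
(* A negative power is reduced to the positive one by cancelling an invertible factor. *)
have AV : A_mx D phi ^+ m.+1 *m A_mx D phi ^- m.+1 = 1.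
  by apply: divrr; rewrite unitrX // A_mx_unit.
have cX_neq0 : cis phi ^+ m.+1 != 0 by rewrite expf_neq0 // cis_neq0.
apply: (mulfI cX_neq0); rewrite -posE NegzE -!exprnN mulmxA AV mul1mx.
by rewrite mulrA divff // mul1r.
Qed.

(** All coordinates share one [(n + 1)]-th power [c], so each is a root of unity times [w p]. Any
    point of [X] can serve as base point. *)
Lemma tight_design_orbit D r n (X : {fset 'cV[R]_2}) p :
  (0 < D)%N -> 0 < r -> tight_design D r n X -> p \in X ->
  [set` X] = group_orbit (cyclic_group D n) p.
Proof.
move=> D_gt0 r_gt0 [design cardX] pX.
have [_ X_sub _] := design.
set phi : R := 2 * pi / n.+1%:R.
pose zeta := cis phi; pose w := ellipse_coord D.
have zeta_prim : n.+1.-primitive_root zeta by apply: cis_primitive.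
have w_inj : injective w by apply: ellipse_coord_inj.
have wp_neq0 : w p != 0 by apply: ellipse_coord_neq0 (X_sub _ pX).
have wX_uniq : uniq [seq w q | q <- enum_fset X].
  by rewrite map_inj_uniq // fset_uniq.
have wX_size : size [seq w q | q <- enum_fset X] = n.+1.
  by rewrite size_map -cardX.
have [c wX_pow] : exists c, forall q, q \in X -> w q ^+ n.+1 = c.
  have [|c cP] := power_sums_eq0_const wX_uniq.
    move=> k; rewrite wX_size ltnS big_map; exact: design_power_sum design.
  by exists c => q qX; rewrite -(cP (w q)) ?wX_size // map_f.
have root_zeta z : z ^+ n.+1 = c -> exists i : 'I_n.+1, z = zeta ^+ i * w p.
  move=> zE; have [|i iE] := prim_rootP zeta_prim (x := z / w p).
    by rewrite expr_div_n zE wX_pow // divff // -(wX_pow p pX) expf_neq0.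
  by exists i; rewrite -iE divfK.
have mem_zeta z : z ^+ n.+1 = c -> z \in [seq zeta ^+ val i * w p | i : 'I_n.+1].
  by move=> /root_zeta[i ->]; exact: (codom_f (fun i : 'I_n.+1 => zeta ^+ val i * w p)).
(* The [n + 1] distinct coordinates of [X] lie in a list of [n + 1] candidates, so they exhaust
   it. *)
have memX q : w q ^+ n.+1 = c -> q \in X.
  move=> /mem_zeta; have [||_ <-] := uniq_min_size wX_uniq
      (s2 := [seq zeta ^+ val i * w p | i : 'I_n.+1]).
  - by move=> z /mapP[v vX ->]; apply/mem_zeta/wX_pow.
  - by rewrite wX_size size_image card_ord.
  by rewrite (mem_map w_inj).
apply/seteqP; split=> q /=.
  move=> qX; have [i iE] := root_zeta _ (wX_pow q qX).
  exists (A_mx D phi ^ Posz i); first by exists (Posz i).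
  by apply: w_inj; rewrite /w ellipse_coord_A_mxX // iE.
move=> [_ [k _ <-] <-]; apply: memX.
rewrite /w ellipse_coord_A_mxX // exprMn (wX_pow p pX).
by rewrite exprnP exprzAC -exprnP (prim_expr_order zeta_prim) exp1rz mul1r.
Qed.

(** * Rational tight designs *)

(** The hypotheses say that [a + b sqrt(-d)] maps [u + v sqrt(-d)] to [u' + v' sqrt(-d)]. The
    witnesses are the components of the quotient, computed with the conjugate and the norm [N]. *)
Lemma rational_rotation (d : nat) (u v u' v' : rat) (a b : R) :
  (ratr u : R) ^+ 2 + d%:R * ratr v ^+ 2 != 0 ->
  ratr u' = a * ratr u - d%:R * b * ratr v ->
  ratr v' = b * ratr u + a * ratr v ->
  exists c s : rat, a = ratr c /\ b = ratr s.
Proof.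
move=> nz u'E v'E; pose N := u ^+ 2 + d%:R * v ^+ 2.
exists ((u * u' + d%:R * v * v') / N), ((u * v' - v * u') / N).
rewrite /N !fmorph_div /= !(rmorphD, rmorphN, rmorphM, rmorphXn, rmorph_nat) /=.
by rewrite u'E v'E; split; field.
Qed.

Lemma rational_tight_design D r n (X : {fset 'cV[R]_2}) :
  (0 < D)%N -> squarefree D -> 0 < r -> (2 <= n)%N ->
  tight_design D r n X -> rational_design X -> D = 1%N \/ D = 3%N.
Proof.
move=> D_gt0 D_sqf r_gt0 n_ge2 tight rat_X.
have [[X_neq0 X_sub _] _] := tight; have /fset0Pn[p pX] := X_neq0.
set phi : R := 2 * pi / n.+1%:R; set q := A_mx D phi *m p.
have s_gt0 := sqrt_nat_gt0 D_gt0; have s_neq0 := gt_eqF s_gt0.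
have qX : q \in X.
  suff : [set` X] q by [].
  rewrite (tight_design_orbit D_gt0 r_gt0 tight pX).
  by exists (A_mx D phi) => //; exists 1.
(* The coordinates of the points have the form [x + y sqrt(-D)] with [x, y] rational. *)
have coord_rat v : v \in X -> exists x y : rat,
    ellipse_coord D v = Complex (ratr x) (Num.sqrt D%:R * ratr y).
  move=> vX; have [x xE] := rat_X v vX ord0; have [y yE] := rat_X v vX ord_max.
  rewrite /ellipse_coord /xc /yc xE yE; case: (D %% 4 == 3)%N.
    exists (x + y / 2), (y / 2).
    by rewrite rmorphD !fmorph_div !rmorph_nat.
  by exists x, y.
have [u [v pE]] := coord_rat p pX; have [u' [v' qE]] := coord_rat q qX.
have sE := sqr_sqrt_nat D.
have [c [s [cE cs]]] : exists c s : rat,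
    cos phi = ratr c /\ sin phi / Num.sqrt D%:R = ratr s.
  have := ellipse_coord_A_mx phi p D_gt0; rewrite -/q qE pE => -[uE vE].
  apply: (@rational_rotation D u v u' v').
  - have := ellipse_coord_norm (X_sub _ pX); rewrite pE /= [(_ * ratr v) ^+ 2]exprMn sE => ->.
    by rewrite gt_eqF.
  - rewrite uE; congr (_ - _); rewrite -{2}sE; field.
    by rewrite s_neq0.
  apply: (mulfI (negbT s_neq0)); rewrite vE; field.
  by rewrite s_neq0.
have N_neq0 : n.+1%:R != 0 :> R by rewrite pnatr_eq0.
have denq1 : denq (2 * c) = 1.
  apply: (@rational_cos_denq R _ phi n.+1) => //; first by rewrite rmorphM rmorph_nat cE.
  by rewrite /phi mulrC divfK // mulrC mulr_natr cos2pi.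
(* Here [n >= 2] enters: it gives [phi < pi], which later excludes [m = 2] and [m = -2]. *)
have sin_gt0 : 0 < sin phi.
  apply: sin_gt0_pi; rewrite /phi divr_gt0 ?mulr_gt0 ?pi_gt0 ?ltr0n //=.
  rewrite ltr_pdivrMr ?ltr0n // mulrC ltr_pM2l ?pi_gt0 //.
  by rewrite (ltr_nat R 2).
pose m := numq (2 * c).
have mE : 2 * c = m%:~R by rewrite -[LHS]divq_num_den denq1 divr1.
(* This is [4 sin^2 phi = 4 - (2 cos phi)^2]. *)
have eqM : D%:R * (2 * s) ^+ 2 = (4 - m ^+ 2)%:~R :> rat.
  rewrite rmorphB rmorphXn /= -mE; apply: (fmorph_inj (@ratr R)).
  rewrite !(rmorphB, rmorphXn, rmorphM, rmorph_nat, rmorph_int) /= -cE -cs.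
  have D_neq0 : D%:R != 0 :> R by rewrite pnatr_eq0 -lt0n.
  rewrite exprMn expr_div_n sE sin2cos2; field.
  by rewrite D_neq0.
have m_lt : 0 < 4 - m ^+ 2.
  rewrite -(ltr_int rat) -eqM mulr_gt0 ?ltr0n // exprn_gt0 // mulr_gt0 //.
  by rewrite -(ltr0q R) -cs divr_gt0.
have [ME|ME] : 4 - m ^+ 2 = 3 \/ 4 - m ^+ 2 = 4.
  have [] : m = 0 \/ m = 1 \/ m = -1 by nia.
  - by move=> ->; right.
  - by case=> ->; left.
- by apply: (@squarefree_mul_sqr_eq D 3 (2 * s)) => //; rewrite eqM ME.
by apply: (@squarefree_mul_sqr_eq D 4 (2 * s)) => //; rewrite eqM ME.
Qed.

End ComplexCoordinate.

Theorem theorem4p4 (R : realType) (D : nat) (r : R) (n : nat)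
    (D_gt0 : (0 < D)%N) (D_sqf : squarefree D) (r_gt0 : 0 < r) :
  (forall X : {fset 'cV[R]_2}, tight_design D r n X ->
     exists2 p : 'cV[R]_2, ellipse D r p &
       [set` X] = group_orbit (cyclic_group D n) p)
  /\
  ((2 <= n)%N ->
   (exists X : {fset 'cV[R]_2}, tight_design D r n X /\ rational_design X) ->
   D = 1%N \/ D = 3%N).

Proof.
split=> [X tight|n_ge2 [X [tight rat_X]]].
  have [[/fset0Pn[p pX] X_sub _] _] := tight.
  exists p; first exact: X_sub.
  exact: tight_design_orbit tight pX.
exact: rational_tight_design tight rat_X.
Qed.
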